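(* Let $\mathcal A$ be a $^*$-algebra over $\mathsf C$ with an approximate identity, let $\Lambda$ be a non-empty set, and let $\mathcal A^{(\Lambda)}=\bigoplus_{i\in\Lambda}\mathcal A$. Then $\mathcal A$ and $\mathfrak F(\mathcal A^{(\Lambda)})$ are formally Morita equivalent. In particular, $\mathcal A$ and $M_n(\mathcal A)$ are formally Morita equivalent for all positive integers $n$.
   Context: $\mathsf R$ is an ordered ring (commutative ring with $1\ne0$ and a subset $\mathsf P$ closed under sums and products such that $\mathsf R$ is the disjoint union $-\mathsf P\cup\{0\}\cup\mathsf P$), and $\mathsf C=\mathsf R(\mathrm i)=\mathsf R\oplus\mathrm i\mathsf R$, $\mathrm i^2=-1$, with the usual conjugation. A $^*$-algebra over $\mathsf C$ is an associative (not necessarily unital) $\mathsf C$-algebra with an antilinear involution satisfying $(AB)^*=B^*A^*$. A linear $\omega:\mathcal A\to\mathsf C$ is positive if $\omega(A^*A)\ge0$ for all $A$; a Hermitian $A$ is positive ($A\ge0$) if $\omega(A)\ge0$ for all positive linear functionals $\omega$. A pre-Hilbert space over $\mathsf C$ is a $\mathsf C$-module with a Hermitian inner product (linear in the second argument), $\langle\phi,\phi\rangle\ge0$, and $\langle\phi,\phi\rangle=0\Rightarrow\phi=0$. A $^*$-representation is a $^*$-homomorphism into the adjointable endomorphisms of a pre-Hilbert space. An approximate identity of $\mathcal A$ is a family $\{\mathcal A_\alpha,E_\alpha\}_{\alpha\in I}$, $I$ directed, with $E_\alpha=E_\alpha^*\in\mathcal A$, $E_\alpha=E_\alpha E_\beta=E_\beta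 E_\alpha$ for $\alpha<\beta$, submodules $\mathcal A_\alpha\subseteq\mathcal A_\beta$ for $\alpha\le\beta$, $\bigcup_\alpha\mathcal A_\alpha=\mathcal A$, and $E_\alpha A=A=AE_\alpha$ for $A\in\mathcal A_\alpha$. $\mathcal A^{(\Lambda)}$ is a right $\mathcal A$-module with $\mathcal A$-valued inner product $\langle w,z\rangle=\sum_iw_i^*z_i$; $\mathfrak F(\mathcal A^{(\Lambda)})$ is the $\mathsf C$-span of the right $\mathcal A$-linear operators $\Theta_{x,y}(z)=x\cdot\langle y,z\rangle$, $x,y\in\mathcal A^{(\Lambda)}$, a $^*$-algebra with $\Theta_{x,y}^*=\Theta_{y,x}$. $M_n(\mathcal A)$ has the usual involution $(a_{ij})^*=(a_{ji}^* )$. A $(\mathcal B$-$\mathcal A)$-equivalence bimodule is a $\mathsf C$-module $\mathfrak X$ with commuting left $\mathcal B$- and right $\mathcal A$-actions and maps $\langle\cdot,\cdot\rangle_{\mathcal A}:\mathfrak X\times\mathfrak X\to\mathcal A$, ${}_{\mathcal B}\langle\cdot,\cdot\rangle:\mathfrak X\times\mathfrak X\to\mathcal B$ such that: E1) X1) $\langle\cdot,\cdot\rangle_{\mathcal A}$ is $\mathsf C$-linear in the second argument; X2) $\langle x,y\rangle_{\mathcal A}=\langle y,x\rangle_{\mathcal A}^*$; X3) $\langle x,y\cdot A\rangle_{\mathcal A}=\langle x,y\rangle_{\mathcal A}A$; X4) $\langle x,x\rangle_{\mathcal A}\ge0$; X5) $\langle x,B\cdot y\rangle_{\mathcal A}=\langle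 B^*\cdot x,y\rangle_{\mathcal A}$; X6) the $\mathsf C$-span of all $\langle x,y\rangle_{\mathcal A}$ is $\mathcal A$. E2) Y1) ${}_{\mathcal B}\langle\cdot,\cdot\rangle$ is $\mathsf C$-linear in the first argument; Y2) ${}_{\mathcal B}\langle x,y\rangle={}_{\mathcal B}\langle y,x\rangle^*$; Y3) ${}_{\mathcal B}\langle B\cdot x,y\rangle=B\,{}_{\mathcal B}\langle x,y\rangle$; Y4) ${}_{\mathcal B}\langle x,x\rangle\ge0$; Y5) ${}_{\mathcal B}\langle x\cdot A,y\rangle={}_{\mathcal B}\langle x,y\cdot A^*\rangle$; Y6) the $\mathsf C$-span of all ${}_{\mathcal B}\langle x,y\rangle$ is $\mathcal B$. E3) ${}_{\mathcal B}\langle x,y\rangle\cdot z=x\cdot\langle y,z\rangle_{\mathcal A}$. E4) P): for every $^*$-representation $(\mathfrak H,\pi)$ of $\mathcal A$ the form $\langle x\otimes\psi,y\otimes\phi\rangle=\langle\psi,\pi(\langle x,y\rangle_{\mathcal A})\phi\rangle$ on $\mathfrak X\otimes_{\mathcal A}\mathfrak H$ is positive semi-definite; and Q): P holds for the conjugate $(\mathcal A$-$\mathcal B)$-bimodule $\overline{\mathfrak X}$ (conjugate $\mathsf C$-module, $A\bar x=\overline{xA^*}$, $\bar xB=\overline{B^*x}$) with $\langle\bar x,\bar y\rangle_{\mathcal B}={}_{\mathcal B}\langle x,y\rangle$. $\mathcal A$ and $\mathcal B$ are formally Morita equivalent if a $(\mathcal B$-$\mathcal A)$-equivalence bimodule exists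 (a symmetric relation). *)

(* Defs.v *)
From HB Require Import structures.
From mathcomp Require Import all_boot all_order all_algebra.
From mathcomp Require Import generic_quotient ring_quotient.
From mathcomp Require Import complex.
From mathcomp Require Import boolp classical_sets functions cardinality fsbigop.
From mathcomp Require Import finmap.

Set Implicit Arguments.
Unset Strict Implicit.
Unset Printing Implicit Defensive.

Import Order.TTheory GRing.Theory Num.Theory.
Local Open Scope ring_scope.

(* The ordered ring R is a realDomainType: the trichotomy forces an ordered
   ring to have no zero divisors. The library makes R[i] a ring only when R is
   a field, so the ring C = R(i) is an alias of R[i] which reuses the
   multiplication mulc and the conjugation conjc of R[i]. *)
Definition cext (R : realDomainType) : Type := R[i].

Section Cext.
Variable R : realDomainType.

HB.instance Definition _ := GRing.Zmodule.copy (cext R) R[i].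

Definition cext1 : cext R := Complex 1 0.
Definition cext_mul : cext R -> cext R -> cext R := @ComplexField.mulc R.

Lemma cext_mul1 : left_id cext1 cext_mul.
Proof. by move=> [a b]; rewrite /cext_mul /= !mul1r !mul0r subr0 addr0. Qed.

Lemma cext_mulDl : left_distributive cext_mul +%R.
Proof.
move=> [a b] [c d] [e f]; congr Complex; rewrite !mulrDl.
  by rewrite opprD addrACA.
by rewrite addrACA.
Qed.

Lemma cext_1neq0 : cext1 != 0.
Proof. by apply/eqP => -[] /eqP; rewrite oner_eq0. Qed.

HB.instance Definition _ := GRing.Zmodule_isComNzRing.Build (cext R)
  (@ComplexField.mulcA R) (@ComplexField.mulcC R)
  cext_mul1 cext_mulDl cext_1neq0.

Definition cconj : cext R -> cext R := @conjc R.

Lemma cconjD : {morph cconj : x y / x + y}.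
Proof. by move=> [a b] [c d]; congr Complex; rewrite opprD. Qed.

Lemma cconjM : {morph cconj : x y / x * y}.
Proof. by move=> [a b] [c d]; congr Complex; rewrite ?mulrN ?mulNr ?opprK ?opprD. Qed.

Lemma cconj1 : cconj 1 = 1.
Proof. by congr Complex; rewrite oppr0. Qed.

Lemma cconjK : involutive cconj.
Proof. by move=> [a b]; congr Complex; rewrite /= opprK. Qed.

Definition cnneg (z : cext R) : bool :=
  (complex.Im z == 0) && (0 <= complex.Re z).

End Cext.

(* Linear spans, as boolean predicates so that they carry the library's
   closedness structure. *)
Section Span.
Variables (K : pzRingType) (V : lmodType K).

Definition lspan (G : set V) : {pred V} := fun v =>
  `[< exists2 s : seq (K * V), (forall p, p \in s -> G p.2) &
        v = \sum_(p <- s) p.1 *: p.2 >].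

Lemma lspan_submod (G : set V) : submod_closed (lspan G).
Proof.
split; first by apply/asboolP; exists [::]; rewrite ?big_nil.
move=> a u v /asboolP[s Gs ->] /asboolP[t Gt ->]; apply/asboolP.
exists ([seq (a * p.1, p.2) | p <- s] ++ t) => [p|].
  by rewrite mem_cat => /orP[/mapP[q /Gs Gq ->]|/Gt].
rewrite big_cat big_map scaler_sumr; congr (_ + _).
by apply: eq_bigr => p _; rewrite scalerA.
Qed.

HB.instance Definition _ (G : set V) :=
  GRing.isSubmodClosed.Build K V (lspan G) (lspan_submod G).

Lemma lspan_gen (G : set V) v : G v -> v \in lspan G.
Proof.
move=> Gv; apply/asboolP; exists [:: (1, v)] => [p|].
  by rewrite inE => /eqP->.
by rewrite big_seq1 scale1r.
Qed.

Lemma lspan_ind (G : set V) (P : V -> Prop) :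
  P 0 -> (forall c u v, G u -> P v -> P (c *: u + v)) ->
  forall v, v \in lspan G -> P v.
Proof.
move=> P0 PD v /asboolP[s sG ->]; elim: s sG => [|p s IH] sG.
  by rewrite big_nil.
rewrite big_cons; apply: PD; first by apply: sG; rewrite mem_head.
by apply: IH => q qs; apply: sG; rewrite inE qs orbT.
Qed.

End Span.

(* lquot G is the quotient of V by the submodule spanned by G. *)
Section Lquot.
Variables (K : pzRingType) (V : lmodType K) (G : set V).
Local Open Scope quotient_scope.

Local Notation Q := (@Quotient.quot V (lspan G)).
Definition lquot : Type := Q.

HB.instance Definition _ := GRing.Zmodule.on lquot.

Definition lquot_pi (v : V) : lquot := \pi_Q v.
Definition lquot_scale (a : K) (x : lquot) : lquot :=
  lquot_pi (a *: repr (x : Q)).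

Lemma lquot_piD : {morph lquot_pi : u v / u + v}.
Proof. by move=> u v; rewrite /lquot_pi piE. Qed.

Lemma lquot_piP u v : (lquot_pi u = lquot_pi v) <-> (u - v \in lspan G).
Proof. by rewrite Quotient.idealrBE; split=> [h|/eqP]; [exact/eqP|]. Qed.

Lemma lquot_reprK (x : lquot) : lquot_pi (repr (x : Q)) = x.
Proof. exact: reprK. Qed.

Lemma lquot_piZ a v : lquot_pi (a *: v) = lquot_scale a (lquot_pi v).
Proof.
apply/lquot_piP; rewrite -scalerBr rpredZ//.
by apply/lquot_piP; rewrite lquot_reprK.
Qed.

Lemma lquot_scaleA a b x :
  lquot_scale a (lquot_scale b x) = lquot_scale (a * b) x.
Proof. by rewrite -[x]lquot_reprK -!lquot_piZ scalerA. Qed.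

Lemma lquot_scale1 : left_id 1 lquot_scale.
Proof. by move=> x; rewrite -[x]lquot_reprK -!lquot_piZ scale1r. Qed.

Lemma lquot_scaleDr : right_distributive lquot_scale +%R.
Proof.
move=> a x y; rewrite -[x]lquot_reprK -[y]lquot_reprK.
by rewrite -lquot_piD -!lquot_piZ scalerDr lquot_piD.
Qed.

Lemma lquot_scaleDl x : {morph lquot_scale^~ x : a b / a + b}.
Proof.
move=> a b; rewrite -[x]lquot_reprK -!lquot_piZ.
by rewrite scalerDl lquot_piD.
Qed.

HB.instance Definition _ := GRing.Zmodule_isLmodule.Build K lquot
  lquot_scaleA lquot_scale1 lquot_scaleDr lquot_scaleDl.

End Lquot.

(* dsum L V is the direct sum of copies of V indexed by L. *)
Section Dsum.
Variables (K : pzRingType) (L : choiceType) (V : lmodType K).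
Local Open Scope classical_set_scope.

Definition finsupp : {pred L -> V} := fun f =>
  `[< finite_set [set i | f i != 0] >].

Lemma finsupp_submod : submod_closed finsupp.
Proof.
split.
  apply/asboolP; rewrite (_ : [set _ | _] = set0) //.
  by apply/seteqP; split=> i //=; rewrite eqxx.
move=> a f g /asboolP ff /asboolP fg; apply/asboolP.
have ffg : finite_set ([set i | f i != 0] `|` [set i | g i != 0]).
  by rewrite finite_setU.
apply: sub_finite_set ffg => i /=; have [f0|] := eqVneq (f i) 0; last by left.
by rewrite /GRing.add /= /GRing.scale /= f0 scaler0 add0r; right.
Qed.

HB.instance Definition _ :=
  GRing.isSubmodClosed.Build K (L -> V) finsupp finsupp_submod.

Record dsum : Type := Dsum { dsum_fun :> L -> V; _ : dsum_fun \in finsupp }.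

HB.instance Definition _ := [isSub for dsum_fun].
HB.instance Definition _ := [Choice of dsum by <:].
HB.instance Definition _ := [SubChoice_isSubLmodule of dsum by <:].

Lemma dsumP (w : dsum) : finite_set [set i | w i != 0].
Proof. by apply/asboolP; case: w. Qed.

Lemma eq_dsum (w z : dsum) : (forall i, w i = z i) -> w = z.
Proof. by move=> wz; apply: val_inj; apply: funext. Qed.

Lemma dsumDE (w z : dsum) i : (w + z) i = w i + z i. Proof. by []. Qed.
Lemma dsumZE a (w : dsum) i : (a *: w) i = a *: w i. Proof. by []. Qed.

Lemma dsum_build_subproof (f : L -> V) (w : dsum) :
  (forall i, w i = 0 -> f i = 0) -> f \in finsupp.
Proof.
move=> fw; apply/asboolP; apply: sub_finite_set (dsumP w) => i /=.
by apply: contraNN => /eqP/fw->.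
Qed.

Lemma dsum_single_subproof (j : L) (v : V) :
  (fun i => if i == j then v else 0) \in finsupp.
Proof.
apply/asboolP; apply: sub_finite_set (finite_set1 j) => i /=.
by case: ifPn => [/eqP|_] //; rewrite eqxx.
Qed.

Definition dsum_single j v : dsum := Dsum (dsum_single_subproof j v).

End Dsum.

HB.mixin Record Lmodule_isStarAlg (R : realDomainType) A
    of GRing.Lmodule (cext R) A := {
  amul : A -> A -> A;
  astar : A -> A;
  amulA : associative amul;
  amulDl : left_distributive amul +%R;
  amulDr : right_distributive amul +%R;
  amulZl : forall c a b, amul (c *: a) b = c *: amul a b;
  amulZr : forall c a b, amul a (c *: b) = c *: amul a b;
  astarD : {morph astar : a b / a + b};
  astarZ : forall c a, astar (c *: a) = cconj c *: astar a;
  astarM : forall a b, astar (amul a b) = amul (astar b) (astar a);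
  astarK : involutive astar
}.

#[short(type="starAlgType")]
HB.structure Definition StarAlg (R : realDomainType) :=
  { A of Lmodule_isStarAlg R A & GRing.Lmodule (cext R) A }.

Notation "a ** b" := (amul a b) (at level 40, left associativity) : ring_scope.

Section Positivity.
Variables (R : realDomainType) (A : starAlgType R).

Definition positive_functional (w : {scalar A}) : Prop :=
  forall a, cnneg (w (astar a ** a)).

Definition alg_nneg (a : A) : Prop :=
  astar a = a /\
  forall w : {scalar A}, positive_functional w -> cnneg (w a).

End Positivity.

HB.mixin Record Lmodule_isPreHilbert (R : realDomainType) H
    of GRing.Lmodule (cext R) H := {
  hip : H -> H -> cext R;
  hip_linear : forall f, scalar (hip f);
  hipC : forall f g, hip f g = cconj (hip g f);
  hip_ge0 : forall f, cnneg (hip f f);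
  hip_eq0 : forall f, hip f f = 0 -> f = 0
}.

#[short(type="preHilbertType")]
HB.structure Definition PreHilbert (R : realDomainType) :=
  { H of Lmodule_isPreHilbert R H & GRing.Lmodule (cext R) H }.

(* A star-homomorphism from A into the adjointable endomorphisms of H; the
   last clause says that pi a is adjointable with adjoint pi (astar a). *)
Record star_representation (R : realDomainType) (A : starAlgType R)
    (H : preHilbertType R) (pi : A -> H -> H) : Prop := {
  srep_endo : forall a, linear (pi a);
  srep_linear : linear pi;
  srepM : forall a b f, pi (a ** b) f = pi a (pi b f);
  srep_star : forall a f g, hip (pi a f) g = hip f (pi (astar a) g)
}.

(* The tensor product over A of a right A-module X and a left A-module H: the
   free C-module on X * H modulo C-bilinearity and A-balancedness. *)
Section Tensor.
Variables (R : realDomainType) (A : Type) (X H : lmodType (cext R)).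
Variables (ract : X -> A -> X) (lact : A -> H -> H).

Let tfree := dsum (X * H)%type (cext R)^o.
Let gen (x : X) (f : H) : tfree := dsum_single (V := (cext R)^o) (x, f) 1.

Inductive tensor_rel : set tfree :=
| TensorDl x y f : tensor_rel (gen (x + y) f - (gen x f + gen y f))
| TensorDr x f g : tensor_rel (gen x (f + g) - (gen x f + gen x g))
| TensorZl c x f : tensor_rel (gen (c *: x) f - c *: gen x f)
| TensorZr c x f : tensor_rel (gen x (c *: f) - c *: gen x f)
| TensorA x a f : tensor_rel (gen (ract x a) f - gen x (lact a f)).

Definition tensor : Type := lquot tensor_rel.

HB.instance Definition _ := GRing.Lmodule.on tensor.

Definition tens (x : X) (f : H) : tensor := lquot_pi tensor_rel (gen x f).

Lemma tens_balanced x a f : tens (ract x a) f = tens x (lact a f).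
Proof. by apply/lquot_piP/lspan_gen; apply: TensorA. Qed.

End Tensor.

Definition sesquilinear (R : realDomainType) (T : lmodType (cext R))
    (b : T -> T -> cext R) : Prop :=
  (forall t, scalar (b t)) /\
  (forall t c u v, b (c *: u + v) t = cconj c * b u t + b v t).

(* Property P for the right A-module X with A-valued inner product ip. The
   form is determined by its values on elementary tensors, which span. *)
Definition propertyP (R : realDomainType) (A : starAlgType R)
    (X : lmodType (cext R)) (ract : X -> A -> X) (ip : X -> X -> A) : Prop :=
  forall (H : preHilbertType R) (pi : A -> H -> H), star_representation pi ->
  exists b : tensor ract pi -> tensor ract pi -> cext R,
    [/\ sesquilinear b,
        forall x f y g,
          b (tens ract pi x f) (tens ract pi y g) = hip f (pi (ip x y) g) &
        forall t, cnneg (b t t)].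

Definition conjmod (R : realDomainType) (X : lmodType (cext R)) : Type := X.

Section Conjmod.
Variables (R : realDomainType) (X : lmodType (cext R)).

HB.instance Definition _ := GRing.Zmodule.copy (conjmod X) X.

Definition conjmod_scale (c : cext R) (x : conjmod X) : conjmod X :=
  cconj c *: (x : X).

Lemma conjmod_scaleA c d x :
  conjmod_scale c (conjmod_scale d x) = conjmod_scale (c * d) x.
Proof. by rewrite /conjmod_scale scalerA cconjM. Qed.

Lemma conjmod_scale1 : left_id 1 conjmod_scale.
Proof. by move=> x; rewrite /conjmod_scale cconj1 scale1r. Qed.

Lemma conjmod_scaleDr : right_distributive conjmod_scale +%R.
Proof. by move=> c x y; rewrite /conjmod_scale -scalerDr. Qed.

Lemma conjmod_scaleDl x : {morph conjmod_scale^~ x : c d / c + d}.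
Proof. by move=> c d; rewrite /conjmod_scale cconjD scalerDl. Qed.

HB.instance Definition _ := GRing.Zmodule_isLmodule.Build (cext R) (conjmod X)
  conjmod_scaleA conjmod_scale1 conjmod_scaleDr conjmod_scaleDl.

End Conjmod.

Section EquivalenceBimodule.
Variables (R : realDomainType) (B A : starAlgType R) (X : lmodType (cext R)).
Variables (lact : B -> X -> X) (ract : X -> A -> X).
Variables (ipA : X -> X -> A) (ipB : X -> X -> B).

Record bimodule_axioms : Prop := {
  lact_linear : forall b, linear (lact b);
  lact_linear_l : linear lact;
  lactM : forall b c x, lact (b ** c) x = lact b (lact c x);
  ract_linear : forall x, linear (ract x);
  ract_linear_l : linear ract;
  ractM : forall x a c, ract x (a ** c) = ract (ract x a) c;
  lract : forall b x a, lact b (ract x a) = ract (lact b x) a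
}.

Record ipA_axioms : Prop := {
  ipA_linear : forall x, linear (ipA x);
  ipA_star : forall x y, ipA x y = astar (ipA y x);
  ipA_ract : forall x y a, ipA x (ract y a) = ipA x y ** a;
  ipA_nneg : forall x, alg_nneg (ipA x x);
  ipA_lact : forall b x y, ipA x (lact b y) = ipA (lact (astar b) x) y;
  ipA_full : forall a, a \in lspan [set c : A | exists x y, c = ipA x y]
}.

Record ipB_axioms : Prop := {
  ipB_linear : forall y, linear (ipB^~ y);
  ipB_star : forall x y, ipB x y = astar (ipB y x);
  ipB_lact : forall b x y, ipB (lact b x) y = b ** ipB x y;
  ipB_nneg : forall x, alg_nneg (ipB x x);
  ipB_ract : forall a x y, ipB (ract x a) y = ipB x (ract y (astar a));
  ipB_full : forall b, b \in lspan [set c : B | exists x y, c = ipB x y]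
}.

Definition conj_ract (x : conjmod X) (b : B) : conjmod X := lact (astar b) x.
Definition conj_ip (x y : conjmod X) : B := ipB x y.

Record equivalence_bimodule_axioms : Prop := {
  equiv_bimodule : bimodule_axioms;
  equiv_ipA : ipA_axioms;
  equiv_ipB : ipB_axioms;
  equiv_compat : forall x y z, lact (ipB x y) z = ract x (ipA y z);
  equiv_P : propertyP ract ipA;
  equiv_Q : propertyP conj_ract conj_ip
}.

End EquivalenceBimodule.

Definition formally_Morita_equivalent (R : realDomainType)
    (A B : starAlgType R) : Prop :=
  exists (X : lmodType (cext R)) (lact : B -> X -> X) (ract : X -> A -> X)
         (ipA : X -> X -> A) (ipB : X -> X -> B),
    equivalence_bimodule_axioms lact ract ipA ipB.

Record approximate_identity (R : realDomainType) (A : starAlgType R)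
    d (I : preorderType d) (S : I -> {pred A}) (E : I -> A) : Prop := {
  ai_directed : forall i j : I, exists k : I, (i <= k)%O && (j <= k)%O;
  ai_star : forall i, astar (E i) = E i;
  ai_mul : forall i j, (i < j)%O -> E i = E i ** E j /\ E i = E j ** E i;
  ai_submod : forall i, submod_closed (S i);
  ai_sub : forall i j, (i <= j)%O -> {subset S i <= S j};
  ai_cover : forall a, exists i, a \in S i;
  ai_unit : forall i a, a \in S i -> E i ** a = a /\ a ** E i = a
}.

Definition has_approximate_identity (R : realDomainType) (A : starAlgType R) :=
  exists (d : Order.disp_t) (I : preorderType d) (S : I -> {pred A})
         (E : I -> A), approximate_identity S E.

Section StarAlgTheory.
Variables (R : realDomainType) (A : starAlgType R).

Lemma amul0l (a : A) : 0 ** a = 0.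
Proof. by rewrite -[0 in LHS](scale0r 0) amulZl scale0r. Qed.

Lemma amul0r (a : A) : a ** 0 = 0.
Proof. by rewrite -[0 in LHS](scale0r 0) amulZr scale0r. Qed.

Lemma astar0 : astar (0 : A) = 0.
Proof. by apply: (addrI (astar 0)); rewrite -astarD !addr0. Qed.

Lemma amul_suml I (s : seq I) (F : I -> A) a :
  (\sum_(i <- s) F i) ** a = \sum_(i <- s) F i ** a.
Proof. by apply: (big_morph (amul^~ a)) => [x y|]; rewrite ?amulDl ?amul0l. Qed.

Lemma amul_sumr I (s : seq I) (F : I -> A) a :
  a ** (\sum_(i <- s) F i) = \sum_(i <- s) a ** F i.
Proof. by apply: (big_morph (amul a)) => [x y|]; rewrite ?amulDr ?amul0r. Qed.

Lemma astar_sum I (s : seq I) (F : I -> A) :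
  astar (\sum_(i <- s) F i) = \sum_(i <- s) astar (F i).
Proof. by apply: (big_morph (@astar R A)) => [x y|]; rewrite ?astarD ?astar0. Qed.

End StarAlgTheory.

Section FreeModule.
Variables (R : realDomainType) (A : starAlgType R) (L : choiceType).
Local Notation D := (dsum L A).
Implicit Types (w x y z : D) (T U : D -> D).

Definition dsum_ract w (a : A) : D :=
  Dsum (dsum_build_subproof (f := fun i => w i ** a) (w := w)
    (fun i wi0 => etrans (congr1 (amul^~ a) wi0) (amul0l a))).

Definition dsum_ip w z : A := \sum_(i \in [set: L]) astar (w i) ** z i.

Lemma dsum_ipE w z (X : {fset L}) : (forall i, z i != 0 -> i \in X) ->
  dsum_ip w z = \sum_(i <- X) astar (w i) ** z i.
Proof.
move=> zX; rewrite /dsum_ip (fsbigTE X) // => i.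
by apply: contraNeq => wzi; apply: zX; apply: contraNneq wzi => ->; rewrite amul0r.
Qed.

Definition dsum_supp z : {fset L} := fset_set [set i | z i != 0].

Lemma dsum_suppP z i : z i != 0 -> i \in dsum_supp z.
Proof. by move=> zi; rewrite in_fset_set; [exact/mem_set|exact: dsumP]. Qed.

Lemma dsum_ip_linear w : linear (dsum_ip w).
Proof.
move=> c x y; pose X := (dsum_supp x `|` dsum_supp y)%fset.
have xX i : x i != 0 -> i \in X by move=> /dsum_suppP xi; rewrite in_fsetU xi.
have yX i : y i != 0 -> i \in X.
  by move=> /dsum_suppP yi; rewrite in_fsetU yi orbT.
rewrite (dsum_ipE _ xX) (dsum_ipE _ yX) (dsum_ipE _ (X := X)); last first.
  move=> i; have [xi0|xi _] := eqVneq (x i) 0; last exact: xX.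
  by rewrite dsumDE dsumZE xi0 scaler0 add0r => /yX.
rewrite scaler_sumr -big_split; apply: eq_bigr => i _.
by rewrite dsumDE dsumZE amulDr amulZr.
Qed.

Lemma dsum_ip_star w z : astar (dsum_ip w z) = dsum_ip z w.
Proof.
pose X := (dsum_supp w `|` dsum_supp z)%fset.
rewrite (dsum_ipE _ (X := X)) => [|i /dsum_suppP zi]; last first.
  by rewrite in_fsetU zi orbT.
rewrite (dsum_ipE _ (X := X)) => [|i /dsum_suppP wi]; last first.
  by rewrite in_fsetU wi.
by rewrite astar_sum; apply: eq_bigr => i _; rewrite astarM astarK.
Qed.

Lemma dsum_ip_ract w z a : dsum_ip w (dsum_ract z a) = dsum_ip w z ** a.
Proof.
rewrite (dsum_ipE _ (@dsum_suppP z)) (dsum_ipE _ (X := dsum_supp z)) => [|i].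
  by rewrite amul_suml; apply: eq_bigr => i _; rewrite amulA.
by move=> zai; apply: dsum_suppP; apply: contraNneq zai => /= ->; rewrite amul0l.
Qed.

Lemma dsum_ipDr w x y : dsum_ip w (x + y) = dsum_ip w x + dsum_ip w y.
Proof. by rewrite -[x in LHS]scale1r dsum_ip_linear scale1r. Qed.

Lemma dsum_ip0r w : dsum_ip w 0 = 0.
Proof. by apply: (addrI (dsum_ip w 0)); rewrite -dsum_ipDr !addr0. Qed.

Lemma dsum_ipZr w c x : dsum_ip w (c *: x) = c *: dsum_ip w x.
Proof. by rewrite -[c *: x]addr0 dsum_ip_linear dsum_ip0r addr0. Qed.

Lemma dsum_ipDl x y z : dsum_ip (x + y) z = dsum_ip x z + dsum_ip y z.
Proof. by rewrite -dsum_ip_star dsum_ipDr astarD !dsum_ip_star. Qed.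

Lemma dsum_ipZl c x z : dsum_ip (c *: x) z = cconj c *: dsum_ip x z.
Proof. by rewrite -dsum_ip_star dsum_ipZr astarZ dsum_ip_star. Qed.

Lemma dsum_ractDr x a b : dsum_ract x (a + b) = dsum_ract x a + dsum_ract x b.
Proof. by apply: eq_dsum => i; rewrite dsumDE /= amulDr. Qed.

Lemma dsum_ractZr x c a : dsum_ract x (c *: a) = c *: dsum_ract x a.
Proof. by apply: eq_dsum => i; rewrite dsumZE /= amulZr. Qed.

Lemma dsum_ractDl x y a : dsum_ract (x + y) a = dsum_ract x a + dsum_ract y a.
Proof. by apply: eq_dsum => i; rewrite !dsumDE /= amulDl. Qed.

Lemma dsum_ractZl c x a : dsum_ract (c *: x) a = c *: dsum_ract x a.
Proof. by apply: eq_dsum => i; rewrite !dsumZE /= amulZl. Qed.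

Lemma dsum_ractA x a b : dsum_ract (dsum_ract x a) b = dsum_ract x (a ** b).
Proof. by apply: eq_dsum => i /=; rewrite amulA. Qed.

Definition Theta x y : D -> D := fun z => dsum_ract x (dsum_ip y z).

Definition is_rank_one : set (D -> D) := [set T | exists x y, T = Theta x y].

(* U is an adjoint of T. *)
Definition dsum_adjoint T U : Prop :=
  forall x y, dsum_ip (U x) y = dsum_ip x (T y).

Lemma dsum_adjoint_sym T U : dsum_adjoint T U -> dsum_adjoint U T.
Proof. by move=> TU x y; rewrite -dsum_ip_star -TU dsum_ip_star. Qed.

Lemma dsum_adjoint_lin c T1 U1 T2 U2 : dsum_adjoint T1 U1 ->
  dsum_adjoint T2 U2 -> dsum_adjoint (c *: T1 + T2) (cconj c *: U1 + U2).
Proof.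
move=> TU1 TU2 x y.
rewrite [(_ + _) x]/(cconj c *: U1 x + U2 x) [(_ + _) y]/(c *: T1 y + T2 y).
by rewrite dsum_ipDl dsum_ipZl cconjK TU1 TU2 dsum_ipDr dsum_ipZr.
Qed.

Lemma dsum_adjoint_comp T1 U1 T2 U2 : dsum_adjoint T1 U1 ->
  dsum_adjoint T2 U2 -> dsum_adjoint (T1 \o T2) (U2 \o U1).
Proof. by move=> TU1 TU2 x y; rewrite TU2 TU1. Qed.

Lemma Theta_adjoint x y : dsum_adjoint (Theta x y) (Theta y x).
Proof.
move=> u v; rewrite -dsum_ip_star !dsum_ip_ract astarM !dsum_ip_star.
by [].
Qed.

Lemma Theta_comp x y u v :
  Theta x y \o Theta u v = Theta (dsum_ract x (dsum_ip y u)) v.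
Proof.
by apply: funext => z; rewrite /Theta /= dsum_ip_ract dsum_ractA.
Qed.

Lemma Theta_ractl x y z a : Theta x y (dsum_ract z a) = dsum_ract (Theta x y z) a.
Proof. by rewrite /Theta dsum_ip_ract dsum_ractA. Qed.

Lemma Theta_linear x y : linear (Theta x y).
Proof.
by move=> c u v; rewrite /Theta dsum_ip_linear dsum_ractDr dsum_ractZr.
Qed.

Record finrank : Type :=
  Finrank { finrank_fun :> D -> D; _ : finrank_fun \in lspan is_rank_one }.

HB.instance Definition _ := [isSub for finrank_fun].
HB.instance Definition _ := [Choice of finrank by <:].
HB.instance Definition _ := [SubChoice_isSubLmodule of finrank by <:].

Lemma finrank_in (T : finrank) : finrank_fun T \in lspan is_rank_one.
Proof. by case: T. Qed.

Lemma finrank_linear T : T \in lspan is_rank_one -> linear T.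
Proof.
move: T; apply: lspan_ind => [c u v|c T U [x [y ->]] Ul d u v].
  by rewrite /GRing.zero /= scaler0 addr0.
have E z : (c *: Theta x y + U) z = c *: Theta x y z + U z by [].
by rewrite !E Ul Theta_linear !scalerDr !scalerA [c * d]mulrC addrACA.
Qed.

Lemma finrank_comp T U : T \in lspan is_rank_one -> U \in lspan is_rank_one ->
  T \o U \in lspan is_rank_one.
Proof.
move=> TF UF; move: T TF.
apply: lspan_ind => [|c T T' [x [y ->]] T'F].
  by rewrite (_ : _ \o _ = 0) ?rpred0.
rewrite (_ : _ \o _ = c *: (Theta x y \o U) + (T' \o U)) //.
rewrite rpredD ?rpredZ // => {T'F T' c}.
move: U UF; apply: lspan_ind => [|c U U' [u [v ->]] U'F].
  rewrite (_ : _ \o _ = 0) ?rpred0//; apply: funext => z /=.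
  by rewrite /Theta /GRing.zero /= dsum_ip0r; apply: eq_dsum => i; rewrite /= amul0r.
rewrite (_ : _ \o _ = c *: (Theta x y \o Theta u v) + (Theta x y \o U')).
  by rewrite Theta_comp rpredD ?rpredZ //; apply: lspan_gen; do 2!eexists.
by apply: funext => z; rewrite /= [LHS]Theta_linear.
Qed.

Lemma finrank_adjoint T : T \in lspan is_rank_one ->
  exists U : finrank, dsum_adjoint T U.
Proof.
suff: T \in lspan is_rank_one ->
    exists2 U, U \in lspan is_rank_one & dsum_adjoint T U.
  by move=> H /H[U UF TU]; exists (Finrank UF).
move: T; apply: lspan_ind => [|c T T' [x [y ->]] [U' U'F TU']].
  exists 0; rewrite ?rpred0 // => x y.
  by rewrite /GRing.zero /= dsum_ip0r -dsum_ip_star dsum_ip0r astar0.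
exists (cconj c *: Theta y x + U').
  by rewrite rpredD ?rpredZ //; apply: lspan_gen; do 2!eexists.
by apply: dsum_adjoint_lin => //; apply: Theta_adjoint.
Qed.

Definition finrank_mul (T U : finrank) : finrank :=
  Finrank (finrank_comp (finrank_in T) (finrank_in U)).

(* The adjoint operator; it is unique as soon as A has an approximate
   identity, see finrank_starE below. *)
Definition finrank_star (T : finrank) : finrank :=
  xget 0 [set U : finrank | dsum_adjoint T U].

Lemma finrank_starP (T : finrank) : dsum_adjoint T (finrank_star T).
Proof.
have [U TU] := finrank_adjoint (finrank_in T).
by apply: (xgetI (P := [set V : finrank | dsum_adjoint T V]) 0 TU).
Qed.

Lemma eq_finrank (T U : finrank) : (forall x, T x = U x) -> T = U.
Proof. by move=> TU; apply: val_inj; apply: funext. Qed.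

Section ApproximateIdentity.
Hypothesis hA : has_approximate_identity A.

Lemma dsum_ip_nondeg x y : (forall z, dsum_ip x z = dsum_ip y z) -> x = y.
Proof.
move=> xy; apply/eqP; rewrite -subr_eq0; apply/eqP; set w := x - y.
have wz z : dsum_ip w z = 0.
  rewrite /w -scaleN1r dsum_ipDl dsum_ipZl xy -[X in X + _]scale1r -scalerDl.
  rewrite (_ : 1 + cconj (-1) = 0) ?scale0r //.
  by congr Complex; rewrite /= ?subrr// !oppr0 addr0.
apply: eq_dsum => i; have [d [I [S [E ai]]]] := hA.
have [k wk] := ai_cover ai (w i).
have := wz (dsum_single i (E k)).
rewrite (dsum_ipE _ (X := [fset i]%fset)) => [|j /=]; last first.
  by case: ifPn => [/eqP-> _|_]; rewrite ?inE ?eqxx.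
rewrite big_seq_fset1 /= eqxx -[E k](ai_star ai) -astarM.
by rewrite (ai_unit ai wk).1 => /(congr1 (@astar R A)); rewrite astarK astar0.
Qed.

Lemma finrank_starE (T U : finrank) : dsum_adjoint T U -> finrank_star T = U.
Proof.
move=> TU; apply: eq_finrank => x; apply: dsum_ip_nondeg => y.
by rewrite (finrank_starP T) TU.
Qed.

End ApproximateIdentity.
End FreeModule.

(* The star-algebra F(A^(L)). The hypothesis hA is what makes the adjoint,
   hence the involution, well defined. *)
Definition finrank_alg (R : realDomainType) (A : starAlgType R)
    (hA : has_approximate_identity A) (L : choiceType) : Type := finrank A L.

Section FinrankAlg.
Variables (R : realDomainType) (A : starAlgType R).
Variables (hA : has_approximate_identity A) (L : choiceType).
Local Notation F := (finrank_alg hA L).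
Implicit Types T U V : F.

HB.instance Definition _ := GRing.Lmodule.copy F (finrank A L).

Let mul : F -> F -> F := @finrank_mul R A L.
Let star : F -> F := @finrank_star R A L.

Lemma finrank_mulA : associative mul.
Proof. by move=> T U V; apply: eq_finrank. Qed.

Lemma finrank_mulDl : left_distributive mul +%R.
Proof. by move=> T U V; apply: eq_finrank. Qed.

Lemma finrank_mulZl c T U : mul (c *: T) U = c *: mul T U.
Proof. exact: eq_finrank. Qed.

Lemma finrank_mulDr : right_distributive mul +%R.
Proof.
move=> T U V; apply: eq_finrank => x.
have := finrank_linear (finrank_in T) 1 (U x) (V x).
by rewrite !scale1r.
Qed.

Lemma finrank_mulZr c T U : mul T (c *: U) = c *: mul T U.
Proof.
apply: eq_finrank => x.
have T0 : T 0 = 0.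
  have := finrank_linear (finrank_in T) (-1) 0 0.
  by rewrite !scaleN1r oppr0 addr0 addNr.
have := finrank_linear (finrank_in T) c (U x) 0.
by rewrite T0 !addr0.
Qed.

Lemma finrank_star_lin c T U : star (c *: T + U) = cconj c *: star T + star U.
Proof.
by apply: (finrank_starE hA); apply: dsum_adjoint_lin; apply: finrank_starP.
Qed.

Lemma finrank_starD : {morph star : T U / T + U}.
Proof.
move=> T U; rewrite -[T in LHS]scale1r finrank_star_lin cconj1.
by rewrite scale1r.
Qed.

Lemma finrank_starZ c T : star (c *: T) = cconj c *: star T.
Proof.
have s0 : star 0 = 0.
  by apply: (addrI (star 0)); rewrite -finrank_starD !addr0.
by rewrite -[c *: T]addr0 finrank_star_lin s0 addr0.
Qed.

Lemma finrank_starM T U : star (mul T U) = mul (star U) (star T).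
Proof.
by apply: (finrank_starE hA); apply: dsum_adjoint_comp; apply: finrank_starP.
Qed.

Lemma finrank_starK : involutive star.
Proof.
move=> T; apply: (finrank_starE hA).
by apply: dsum_adjoint_sym; apply: finrank_starP.
Qed.

HB.instance Definition _ := Lmodule_isStarAlg.Build R F
  finrank_mulA finrank_mulDl finrank_mulDr finrank_mulZl finrank_mulZr
  finrank_starD finrank_starZ finrank_starM finrank_starK.

Lemma finrank_Theta (x y : dsum L A) : Theta x y \in lspan (@is_rank_one R A L).
Proof. by apply: lspan_gen; do 2!eexists. Qed.

Definition rank_one (x y : dsum L A) : F := Finrank (finrank_Theta x y).

Lemma astar_rank_one x y : astar (rank_one x y) = rank_one y x.
Proof. by apply: (finrank_starE hA); apply: Theta_adjoint. Qed.

End FinrankAlg.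

Definition mx_alg (R : realDomainType) (A : starAlgType R) (n : nat) : Type :=
  'M[A]_n.

Section MatrixAlg.
Variables (R : realDomainType) (A : starAlgType R) (n : nat).
Local Notation M := (mx_alg A n).
Implicit Types a b c : M.

HB.instance Definition _ := GRing.Zmodule.copy M 'M[A]_n.

Definition mx_alg_scale (k : cext R) a : M := \matrix_(i, j) (k *: a i j).
Definition mx_alg_mul a b : M := \matrix_(i, j) \sum_k a i k ** b k j.
Definition mx_alg_star a : M := \matrix_(i, j) astar (a j i).

Lemma mx_alg_scaleA k l a :
  mx_alg_scale k (mx_alg_scale l a) = mx_alg_scale (k * l) a.
Proof. by apply/matrixP => i j; rewrite !mxE scalerA. Qed.

Lemma mx_alg_scale1 : left_id 1 mx_alg_scale.
Proof. by move=> a; apply/matrixP => i j; rewrite !mxE scale1r. Qed.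

Lemma mx_alg_scaleDr : right_distributive mx_alg_scale +%R.
Proof. by move=> k a b; apply/matrixP => i j; rewrite !mxE scalerDr. Qed.

Lemma mx_alg_scaleDl a : {morph mx_alg_scale^~ a : k l / k + l}.
Proof. by move=> k l; apply/matrixP => i j; rewrite !mxE scalerDl. Qed.

HB.instance Definition _ := GRing.Zmodule_isLmodule.Build (cext R) M
  mx_alg_scaleA mx_alg_scale1 mx_alg_scaleDr mx_alg_scaleDl.

Lemma mx_alg_mulA : associative mx_alg_mul.
Proof.
move=> a b c; apply/matrixP => i j; rewrite !mxE.
under eq_bigr do rewrite mxE amul_sumr.
under [RHS]eq_bigr do rewrite mxE amul_suml.
rewrite exchange_big; apply: eq_bigr => k _; apply: eq_bigr => l _.
by rewrite amulA.
Qed.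

Lemma mx_alg_mulDl : left_distributive mx_alg_mul +%R.
Proof.
move=> a b c; apply/matrixP => i j; rewrite !mxE -big_split /=.
by apply: eq_bigr => k _; rewrite !mxE amulDl.
Qed.

Lemma mx_alg_mulDr : right_distributive mx_alg_mul +%R.
Proof.
move=> a b c; apply/matrixP => i j; rewrite !mxE -big_split /=.
by apply: eq_bigr => k _; rewrite !mxE amulDr.
Qed.

Lemma mx_alg_mulZl k a b : mx_alg_mul (k *: a) b = k *: mx_alg_mul a b.
Proof.
apply/matrixP => i j; rewrite !mxE scaler_sumr.
by apply: eq_bigr => l _; rewrite !mxE amulZl.
Qed.

Lemma mx_alg_mulZr k a b : mx_alg_mul a (k *: b) = k *: mx_alg_mul a b.
Proof.
apply/matrixP => i j; rewrite !mxE scaler_sumr.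
by apply: eq_bigr => l _; rewrite !mxE amulZr.
Qed.

Lemma mx_alg_starD : {morph mx_alg_star : a b / a + b}.
Proof. by move=> a b; apply/matrixP => i j; rewrite !mxE astarD. Qed.

Lemma mx_alg_starZ k a : mx_alg_star (k *: a) = cconj k *: mx_alg_star a.
Proof. by apply/matrixP => i j; rewrite !mxE astarZ. Qed.

Lemma mx_alg_starM a b :
  mx_alg_star (mx_alg_mul a b) = mx_alg_mul (mx_alg_star b) (mx_alg_star a).
Proof.
apply/matrixP => i j; rewrite !mxE astar_sum.
by apply: eq_bigr => k _; rewrite !mxE astarM.
Qed.

Lemma mx_alg_starK : involutive mx_alg_star.
Proof. by move=> a; apply/matrixP => i j; rewrite !mxE astarK. Qed.

HB.instance Definition _ := Lmodule_isStarAlg.Build R M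
  mx_alg_mulA mx_alg_mulDl mx_alg_mulDr mx_alg_mulZl mx_alg_mulZr
  mx_alg_starD mx_alg_starZ mx_alg_starM mx_alg_starK.

End MatrixAlg.

(* Main.v *)
(* The bimodule is X = A^(L), with <x, y>_A = sum_i x_i^* y_i; on the other side
   <x, y>_B is Theta_{x,y}, or the matrix (x_i y_j^* )_{ij} when B = M_n(A).
   Positivity and the properties P and Q come from one observation: if on every
   finite subset of X an inner product factors as sum_k G_k(x)^* G_k(y), then
   its values <x, x> are positive, and in any star-representation pi
     sum_{p,q} <f_p, pi <x_p, x_q> f_q> = sum_k ||sum_p pi (G_k x_p) f_p||^2.
   For <,>_A the G_k are the coordinates. For <,>_B, the approximate identity
   gives for each finite subset some e in X with x <e, e>_A = x on it, and
   then <x, y>_B = <e, x>_B^* <e, y>_B. *)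
Require Import Defs.
From mathcomp Require Import all_boot all_order all_algebra.
From mathcomp Require Import boolp classical_sets functions cardinality fsbigop.
From mathcomp Require Import finmap.

Set Implicit Arguments.
Unset Strict Implicit.
Unset Printing Implicit Defensive.

Import Order.TTheory GRing.Theory Num.Theory.
Local Open Scope ring_scope.

(** * Maps known only by a proof of additivity or linearity *)

Lemma additive_sum (U V : zmodType) (f : U -> V) I (s : seq I) (F : I -> U) :
  {morph f : u v / u + v} -> f (\sum_(i <- s) F i) = \sum_(i <- s) f (F i).
Proof.
move=> fD; have f0 : f 0 = 0 by apply: (addrI (f 0)); rewrite -fD !addr0.
exact: (big_morph f fD f0).
Qed.

Section LinearProp.
Variables (K : pzRingType) (U V : lmodType K) (f : U -> V).
Hypothesis fl : linear f.

Lemma linear_propD : {morph f : u v / u + v}.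
Proof. by move=> u v; rewrite -[u in LHS]scale1r fl scale1r. Qed.

Lemma linear_prop0 : f 0 = 0.
Proof. by apply: (addrI (f 0)); rewrite -linear_propD !addr0. Qed.

Lemma linear_propZ c u : f (c *: u) = c *: f u.
Proof. by rewrite -[c *: u]addr0 fl linear_prop0 addr0. Qed.

Lemma linear_propB u v : f (u - v) = f u - f v.
Proof. by rewrite addrC -scaleN1r fl scaleN1r addrC. Qed.

End LinearProp.

Lemma cnneg_sum (R : realDomainType) I (s : seq I) (F : I -> cext R) :
  (forall i, cnneg (F i)) -> cnneg (\sum_(i <- s) F i).
Proof.
move=> F0; elim: s => [|i s IH]; first by rewrite big_nil /cnneg /= eqxx lexx.
rewrite big_cons; move: (F0 i) IH; rewrite /cnneg.
case: (F i) (\sum_(j <- s) F j) => [a b] [c d] /= /andP[/eqP-> a0] /andP[/eqP-> c0].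
by rewrite addr0 eqxx addr_ge0.
Qed.

(** * Linear maps out of a free module *)

Section FreeEval.
Variables (K : comPzRingType) (P : choiceType) (V : lmodType K).
Variable phi : P -> V.
Local Notation free := (dsum P K^o).
Local Open Scope classical_set_scope.

(** The linear extension of [phi] from the basis [P] to the free module on [P]. *)
Definition free_eval (w : free) : V :=
  \sum_(i \in [set: P]) (w i : K) *: phi i.

Lemma free_evalE (w : free) (X : {fset P}) : (forall i, w i != 0 -> i \in X) ->
  free_eval w = \sum_(i <- X) (w i : K) *: phi i.
Proof.
move=> wX; rewrite /free_eval (fsbigTE X) // => i.
by apply: contraNeq => wi; apply: wX; apply: contraNneq wi => ->; rewrite scale0r.
Qed.

Definition free_supp (w : free) : {fset P} := fset_set [set i | w i != 0].

Lemma free_suppP (w : free) i : w i != 0 -> i \in free_supp w.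
Proof. by move=> wi; rewrite in_fset_set; [exact/mem_set|exact: dsumP]. Qed.

Lemma free_eval_linear : linear free_eval.
Proof.
move=> c x y; pose X := (free_supp x `|` free_supp y)%fset.
have xX i : x i != 0 -> i \in X by move=> /free_suppP xi; rewrite in_fsetU xi.
have yX i : y i != 0 -> i \in X.
  by move=> /free_suppP yi; rewrite in_fsetU yi orbT.
rewrite (free_evalE xX) (free_evalE yX) (free_evalE (X := X)); last first.
  move=> i; have [xi0|xi _] := eqVneq (x i) 0; last exact: xX.
  by rewrite dsumDE dsumZE xi0 scaler0 add0r => /yX.
rewrite scaler_sumr -big_split; apply: eq_bigr => i _.
by rewrite dsumDE dsumZE scalerDl scalerA.
Qed.

Lemma free_eval_single i : free_eval (dsum_single (V := K^o) i 1) = phi i.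
Proof.
rewrite (free_evalE (X := [fset i]%fset)) => [|j /=]; last first.
  by case: ifPn => [/eqP-> _|_]; rewrite ?inE ?eqxx.
by rewrite big_seq_fset1 /= eqxx scale1r.
Qed.

End FreeEval.

Lemma free_decomposition (K : comPzRingType) (P : choiceType)
    (w : dsum P K^o) :
  w = \sum_(i <- free_supp w) (w i : K) *: dsum_single (V := K^o) i 1.
Proof.
apply: eq_dsum => j.
rewrite (additive_sum _ _ (f := fun z : dsum P K^o => z j)); last by [].
under eq_bigr do rewrite dsumZE /= [_ *: _](fun_if (GRing.mul _)) mulr1 mulr0.
have [wj|wj] := boolP (j \in free_supp w).
  rewrite (big_fsetD1 j) //= eqxx big1_seq ?addr0 // => i /= /[!inE]/andP[ij _].
  by rewrite eq_sym (negPf ij).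
rewrite big1_seq => [|i /= wi].
  by apply/eqP; apply: contraNT wj => /free_suppP.
by case: eqP => // ji; rewrite ji wi in wj.
Qed.

(** * The universal property of the tensor product *)

Section TensorLift.
Variables (R : realDomainType) (A : Type) (X H : lmodType (cext R)).
Variables (ract : X -> A -> X) (lact : A -> H -> H).
Local Notation T := (tensor ract lact).

Lemma lquot_pi_linear (V : lmodType (cext R)) (G : set V) :
  linear (lquot_pi G : V -> lquot G).
Proof. by move=> c u v; rewrite lquot_piD lquot_piZ. Qed.

Lemma tens_linearr x : linear (tens ract lact x).
Proof.
move=> c f g; have TD u v : tens ract lact x (u + v) =
    tens ract lact x u + tens ract lact x v.
  by rewrite /tens -lquot_piD; apply/lquot_piP/lspan_gen; apply: TensorDr.
rewrite TD; congr (_ + _); rewrite /tens.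
rewrite -[in RHS](linear_propZ (lquot_pi_linear _)).
by apply/lquot_piP/lspan_gen; apply: TensorZr.
Qed.

(** Expand a representative of [t] in the basis of pairs; no coefficients remain because each is
    absorbed into the second factor. *)
Lemma tensor_decomposition (t : T) :
  exists s : seq (X * H), t = \sum_(p <- s) tens ract lact p.1 p.2.
Proof.
pose w := repr (t : Quotient.quot (lspan (tensor_rel ract lact))).
exists [seq (p.1, (w p : cext R) *: p.2) | p <- free_supp w].
rewrite -[LHS](lquot_reprK t) -/w [w in LHS]free_decomposition big_map.
rewrite (additive_sum _ _ (@lquot_piD _ _ _)); apply: eq_bigr => -[x f] _ /=.
rewrite (linear_propZ (@tens_linearr x)).
exact: (linear_propZ (lquot_pi_linear _)).
Qed.

(** Existence half of the universal property: the linear extension of [phi] to the free module kills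
    the defining relations, hence descends to the quotient. *)
Lemma tensor_lift (V : lmodType (cext R)) (phi : X -> H -> V) :
  (forall x, linear (phi x)) -> (forall f, linear (phi^~ f)) ->
  (forall x a f, phi (ract x a) f = phi x (lact a f)) ->
  exists2 g : T -> V, linear g & forall x f, g (tens ract lact x f) = phi x f.
Proof.
move=> phir phil phia.
pose e := free_eval (fun p : X * H => phi p.1 p.2).
have el : linear e := free_eval_linear _.
have eB := linear_propB el; have eD := linear_propD el.
have eZ := linear_propZ el.
have e1 x f : e (dsum_single (V := (cext R)^o) (x, f) 1) = phi x f.
  exact: free_eval_single.
have e0 w : w \in lspan (tensor_rel ract lact) -> e w = 0.
  move: w; apply: lspan_ind => [|c u v Gu ev]; first exact: linear_prop0 el.
  rewrite el ev addr0; suff -> : e u = 0 by rewrite scaler0.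
  case: {c v ev} u / Gu => *; rewrite eB ?eD ?eZ !e1.
  - by rewrite (linear_propD (phil _)) subrr.
  - by rewrite (linear_propD (phir _)) subrr.
  - by rewrite (linear_propZ (phil _)) subrr.
  - by rewrite (linear_propZ (phir _)) subrr.
  - by rewrite phia subrr.
pose g (t : T) := e (repr (t : Quotient.quot (lspan (tensor_rel ract lact)))).
(* The chosen representative of the class of [w] differs from [w] by an element of the span of the
   relations, where [e] vanishes. *)
have gpi w : g (lquot_pi _ w) = e w.
  apply/eqP; rewrite -subr_eq0 -eB; apply/eqP/e0.
  by apply/lquot_piP; rewrite lquot_reprK.
exists g => [c t u|x f]; last by rewrite gpi e1.
by rewrite -[t]lquot_reprK -[u]lquot_reprK -[X in g X]lquot_pi_linear !gpi el.
Qed.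

Lemma eq_tensor_linear (V : lmodType (cext R)) (g h : T -> V) :
  linear g -> linear h ->
  (forall x f, g (tens ract lact x f) = h (tens ract lact x f)) -> g = h.
Proof.
move=> gl hl gh; apply: funext => t; have [s ->] := tensor_decomposition t.
rewrite (additive_sum _ _ (linear_propD gl)) (additive_sum _ _ (linear_propD hl)).
exact: eq_bigr.
Qed.

End TensorLift.

(** * Positivity and property P from local sums of squares *)

Section SumsOfSquares.
Variables (R : realDomainType) (A : starAlgType R) (X : lmodType (cext R)).

(* On every finite subset of X, the form ip factors as
   <x, y> = sum_k G_k(x)^* G_k(y). *)
Definition locally_sum_of_squares (ip : X -> X -> A) : Prop :=
  forall s : seq X, exists r : seq (X -> A), forall x y, x \in s -> y \in s ->
    ip x y = \sum_(G <- r) astar (G x) ** G y.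

Lemma local_squares_nneg (ip : X -> X -> A) :
  (forall x y, ip x y = astar (ip y x)) ->
  locally_sum_of_squares ip -> forall x, alg_nneg (ip x x).
Proof.
move=> ipC ipS x; split=> [|w w0]; first by rewrite -ipC.
have [r ->] := ipS [:: x]; rewrite ?mem_head// raddf_sum.
by apply: cnneg_sum => G; apply: w0.
Qed.

(** The form is obtained by lifting twice, first in the linear second argument and then in the
    conjugate-linear first one. Local factorisation enters only in the proof of positivity, since a
    tensor involves finitely many elements of [X]. *)
Lemma local_squares_propertyP (ract : X -> A -> X) (ip : X -> X -> A) :
  (forall x, linear (ip x)) -> (forall x y, ip x y = astar (ip y x)) ->
  (forall x y a, ip x (ract y a) = ip x y ** a) ->
  locally_sum_of_squares ip -> propertyP ract ip.
Proof.
move=> ipl ipC ipr ipS H pi piP.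
have pil := srep_linear piP; have piel := srep_endo piP.
have piM := srepM piP; have piS := srep_star piP.
have hl f : linear (hip f : H -> (cext R)^o) := hip_linear f.
have hipDl (f1 f2 g : H) : hip (f1 + f2) g = hip f1 g + hip f2 g :> cext R.
  by rewrite hipC (linear_propD (hl g)) cconjD -!hipC.
have hipZl c (f g : H) : hip (c *: f) g = cconj c * hip f g :> cext R.
  by rewrite hipC (linear_propZ (hl g)) [_ *: _]/(_ * _) cconjM -hipC.
have ipDl x y z : ip (x + y) z = ip x z + ip y z.
  by rewrite ipC (linear_propD (ipl z)) astarD -!ipC.
have ipZl c x z : ip (c *: x) z = cconj c *: ip x z.
  by rewrite ipC (linear_propZ (ipl z)) astarZ -ipC.
have ipra x a y : ip (ract x a) y = astar a ** ip x y.
  by rewrite ipC ipr astarM -ipC.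
have piD a b f : pi (a + b) f = pi a f + pi b f by rewrite (linear_propD pil).
have piZ c a f : pi (c *: a) f = c *: pi a f by rewrite (linear_propZ pil).
(* With the left elementary tensor [p] fixed, pairing against [p] is a linear functional on the
   tensor product. *)
have inner (p : X * H) : exists g : tensor ract pi -> (cext R)^o,
    linear g /\ forall y f, g (tens ract pi y f) = hip p.2 (pi (ip p.1 y) f).
  have [||y a f|g gl gE] := @tensor_lift R A X H ract pi (cext R)^o
      (fun y f => hip p.2 (pi (ip p.1 y) f)).
  - by move=> y c f1 f2; rewrite piel hl.
  - by move=> f c y1 y2; rewrite ipl piD piZ hl.
  - by rewrite ipr piM.
  by exists g.
have [g gP] := choice inner.
(* These combinations are linear too, so [eq_tensor_linear] can compare them with some [g r] on
   elementary tensors. *)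
have gl c p q : linear (fun t => cconj c *: g p t + g q t).
  move=> d t u; rewrite !(gP _).1 !scalerDr !scalerA mulrC.
  by rewrite addrACA.
(* Taking values in the conjugate module turns conjugate-linearity of [g] in [x] and in [f] into the
   linearity that the lift requires. *)
have [|||B Bl BE] := @tensor_lift R A X H ract pi
    (conjmod (tensor ract pi -> (cext R)^o)) (fun x f => g (x, f)).
- move=> x c f1 f2.
  apply: (@eq_tensor_linear _ _ _ _ _ _ _ _ _ (gP _).1 (gl c (x, f1) (x, f2))).
  by move=> y f; rewrite !(gP _).2 /= hipDl hipZl.
- move=> f c x1 x2.
  apply: (@eq_tensor_linear _ _ _ _ _ _ _ _ _ (gP _).1 (gl c (x1, f) (x2, f))).
  by move=> y h; rewrite !(gP _).2 /= ipDl ipZl piD piZ hl.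
- move=> x a f.
  apply: (@eq_tensor_linear _ _ _ _ _ _ _ _ _ (gP _).1 (gP _).1).
  by move=> y h; rewrite !(gP _).2 /= ipra piM piS.
(* The target of [B] consists of arbitrary functions, so linearity of [B t] is recovered by writing
   it as a finite sum of functionals [g p]. *)
have Btl t : linear (B t : tensor ract pi -> (cext R)^o).
  have [s ->] := tensor_decomposition t.
  rewrite (additive_sum _ _ (linear_propD Bl)) => c u v.
  have E (w : tensor ract pi) : (\sum_(p <- s) B (tens ract pi p.1 p.2) :
      tensor ract pi -> (cext R)^o) w
      = \sum_(p <- s) (B (tens ract pi p.1 p.2) : _ -> (cext R)^o) w.
    by rewrite (additive_sum _ _ (f := fun k : conjmod (tensor ract pi ->
      (cext R)^o) => (k : tensor ract pi -> (cext R)^o) w)).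
  rewrite !E scaler_sumr -big_split; apply: eq_bigr => p _ /=.
  by rewrite BE (gP _).1.
have Bsl t c u v : (B (c *: u + v) t : cext R) = cconj c * B u t + B v t.
  by rewrite Bl.
exists (fun t u => B t u); split=> [|x f y h|t].
- by split=> [t c u v|t c u v]; [exact: Btl|exact: Bsl].
- by rewrite BE (gP _).2.
have [s ->] := tensor_decomposition t.
have [r ipE] := ipS [seq p.1 | p <- s].
pose v (G : X -> A) : H := \sum_(p <- s) pi (G p.1) p.2.
rewrite (_ : B _ _ = \sum_(G <- r) hip (v G) (v G)); last first.
  have hDl g1 : {morph (fun f : H => hip f g1 : cext R) : f1 f2 / f1 + f2}.
    by move=> f1 f2; exact: hipDl.
  (* Both sides equal this triple sum: the factorisation of [ip] and adjointness of [pi] give it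
     from the form, and summing over [p] and [q] first gives the squares of the [v G]. *)
  transitivity (\sum_(p <- s) \sum_(q <- s) \sum_(G <- r)
      (hip (pi (G p.1) p.2) (pi (G q.1) q.2) : cext R)).
    rewrite (additive_sum _ _ (linear_propD (Btl _))) exchange_big /= big_seq_cond
      [RHS]big_seq_cond.
    apply: eq_bigr => q /andP[qs _].
    rewrite (additive_sum _ _ (f := fun t => (B t (tens ract pi q.1 q.2) : cext R)));
      last by move=> u1 u2; rewrite (linear_propD Bl).
    rewrite big_seq_cond [RHS]big_seq_cond; apply: eq_bigr => p /andP[ps _].
    rewrite BE (gP _).2 /= ipE ?map_f//.
    rewrite (additive_sum _ _ (f := fun a => (hip p.2 (pi a q.2) : cext R)));
      last by move=> a1 a2; rewrite piD (linear_propD (hl _)).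
    by apply: eq_bigr => G _; rewrite piM piS.
  under eq_bigr do rewrite exchange_big.
  rewrite exchange_big; apply: eq_bigr => G _ /=.
  rewrite (additive_sum _ _ (hDl _)); apply: eq_bigr => p _.
  by rewrite (additive_sum _ _ (linear_propD (hl _))).
by apply: cnneg_sum => G; apply: hip_ge0.
Qed.

End SumsOfSquares.

(** * Equivalence bimodules from local units *)

Section LocalUnits.
Variables (R : realDomainType) (B A : starAlgType R) (X : lmodType (cext R)).
Variables (lact : B -> X -> X) (ract : X -> A -> X).
Variables (ipA : X -> X -> A) (ipB : X -> X -> B).

Hypothesis X_bimodule : bimodule_axioms lact ract.
Hypothesis ipA_lin : forall x, linear (ipA x).
Hypothesis ipA_C : forall x y, ipA x y = astar (ipA y x).
Hypothesis ipA_r : forall x y a, ipA x (ract y a) = ipA x y ** a.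
Hypothesis ipA_l : forall b x y, ipA x (lact b y) = ipA (lact (astar b) x) y.
Hypothesis ipA_span : forall a, a \in lspan [set c : A | exists x y, c = ipA x y].
Hypothesis ipB_lin : forall y, linear (ipB^~ y).
Hypothesis ipB_C : forall x y, ipB x y = astar (ipB y x).
Hypothesis ipB_l : forall b x y, ipB (lact b x) y = b ** ipB x y.
Hypothesis ipB_r : forall a x y, ipB (ract x a) y = ipB x (ract y (astar a)).
Hypothesis ipB_span : forall b, b \in lspan [set c : B | exists x y, c = ipB x y].
Hypothesis compat : forall x y z, lact (ipB x y) z = ract x (ipA y z).
Hypothesis ipA_squares : locally_sum_of_squares ipA.
Hypothesis local_unit :
  forall s : seq X, exists e, forall x, x \in s -> ract x (ipA e e) = x.

(* <x, y>_B = <x<e, e>_A, y>_B = <<x, e>_B e, y>_B = <x, e>_B <e, y>_B. *)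
Lemma local_unit_squares : locally_sum_of_squares ipB.
Proof.
move=> s; have [e eP] := local_unit s; exists [:: ipB e] => x y xs _.
by rewrite big_seq1 -ipB_C -ipB_l compat eP.
Qed.

Lemma local_unit_equivalence : equivalence_bimodule_axioms lact ract ipA ipB.
Proof.
split=> //.
- by split=> //; apply: local_squares_nneg.
- by split=> //; apply: local_squares_nneg => //; apply: local_unit_squares.
- exact: local_squares_propertyP.
(* Property Q is property P for the conjugate module, where conjugate-linearity of [ipB] in its
   second argument becomes linearity. *)
apply: (@local_squares_propertyP R B (conjmod X)).
- move=> x c y z; rewrite /conj_ip ipB_C [RHS](_ : _ = c *: ipB x y + ipB x z) //.
  rewrite (_ : c *: y + z = (cconj c *: (y : X) + z : X)) // ipB_lin.
  by rewrite astarD astarZ cconjK -!ipB_C.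
- by move=> x y; apply: ipB_C.
- move=> x y b; rewrite /conj_ip /conj_ract ipB_C ipB_l astarM astarK.
  by rewrite -ipB_C.
exact: local_unit_squares.
Qed.

End LocalUnits.

(** * The free module as an equivalence bimodule, and its finite rank operators *)

Section FreeModuleEquivalence.
Variables (R : realDomainType) (A : starAlgType R).
Hypothesis hA : has_approximate_identity A.

(** By directedness, one submodule of the approximate identity contains the whole list, and its
    [E k] serves. *)
Lemma approximate_unit (s : seq A) :
  exists E : A, astar E = E /\ forall a, a \in s -> E ** a = a /\ a ** E = a.
Proof.
have [d [I [S [E ai]]]] := hA.
suff [k kP] : exists k, forall a, a \in s -> a \in S k.
  by exists (E k); split=> [|a /kP]; [exact: ai_star ai k|exact: (ai_unit ai)].
elim: s => [|a s [k kP]]; first by have [k _] := ai_cover ai 0; exists k.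
have [l al] := ai_cover ai a; have [m /andP[km lm]] := ai_directed ai k l.
exists m => b; rewrite inE => /orP[/eqP->|/kP]; first exact: (ai_sub ai) lm _ al.
exact: (ai_sub ai).
Qed.

Variable L : choiceType.
Local Notation D := (dsum L A).

Lemma dsum_ip_singler (w : D) j a :
  dsum_ip w (dsum_single j a) = astar (w j) ** a.
Proof.
rewrite (dsum_ipE _ (X := [fset j]%fset)) => [|i /=]; last first.
  by case: ifPn => [/eqP-> _|_]; rewrite ?inE ?eqxx.
by rewrite big_seq_fset1 /= eqxx.
Qed.

Lemma dsum_ip_squares : locally_sum_of_squares (@dsum_ip R A L).
Proof.
move=> s; pose X := (\bigcup_(x <- s) dsum_supp x)%fset.
(* The coordinates in the union of the supports suffice, as [y i] vanishes outside it. *)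
exists [seq (fun x : D => x i) | i <- X] => x y _ ys; rewrite big_map.
apply: dsum_ipE => i /dsum_suppP iy; apply/bigfcupP; exists y => //.
by rewrite ys.
Qed.

(** Take a unit [E] for all non-zero coordinates of the list and place it at [j]: then [dsum_ip e e]
    is [E ** E], which fixes each of these coordinates on the right. *)
Lemma dsum_local_unit (j : L) (s : seq D) :
  exists e : D, forall x, x \in s -> dsum_ract x (dsum_ip e e) = x.
Proof.
have [E [Es EP]] := approximate_unit [seq x i | x : D <- s, i : L <- dsum_supp x].
exists (dsum_single j E) => x xs; rewrite dsum_ip_singler /= eqxx Es.
apply: eq_dsum => i /=; have [->|xi] := eqVneq (x i) 0; first by rewrite amul0l.
have xiE : x i ** E = x i.
  by apply: (EP _ _).2; apply: allpairs_f_dep => //; apply: dsum_suppP.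
by rewrite amulA !xiE.
Qed.

Lemma dsum_ip_full (j : L) a :
  a \in lspan [set c : A | exists x y : D, c = dsum_ip x y].
Proof.
have [E [Es EP]] := approximate_unit [:: a].
apply: lspan_gen; exists (dsum_single j E), (dsum_single j a).
by rewrite dsum_ip_singler /= eqxx Es (EP _ (mem_head _ _)).1.
Qed.

Section Bimodule.
Variables (B : starAlgType R) (lact : B -> D -> D) (ipB : D -> D -> B).
Hypothesis lact_lin : forall b, linear (lact b).
Hypothesis lact_lin_l : linear lact.
Hypothesis lact_M : forall b c x, lact (b ** c) x = lact b (lact c x).
Hypothesis lact_r : forall b x a, lact b (dsum_ract x a) = dsum_ract (lact b x) a.
Hypothesis lact_adjoint : forall b, dsum_adjoint (lact b) (lact (astar b)).
Hypothesis ipB_lin : forall y, linear (ipB^~ y).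
Hypothesis ipB_C : forall x y, ipB x y = astar (ipB y x).
Hypothesis ipB_l : forall b x y, ipB (lact b x) y = b ** ipB x y.
Hypothesis ipB_r :
  forall a x y, ipB (dsum_ract x a) y = ipB x (dsum_ract y (astar a)).
Hypothesis ipB_span : forall b, b \in lspan [set c : B | exists x y, c = ipB x y].
Hypothesis compat : forall x y z, lact (ipB x y) z = dsum_ract x (dsum_ip y z).

(** Common core of both halves of the theorem: the right-hand structure is always the same, and only
    [B], its action and [ipB] vary. A point of [L] is needed to place the units. *)
Lemma dsum_Morita_equivalent : inhabited L -> formally_Morita_equivalent A B.
Proof.
case=> j; exists (dsum L A), lact, (@dsum_ract R A L), (@dsum_ip R A L), ipB.
apply: local_unit_equivalence => //.
- split=> //.
  + by move=> x c a b; rewrite dsum_ractDr dsum_ractZr.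
  + by move=> c x y; apply: funext => a; rewrite dsum_ractDl dsum_ractZl.
  + by move=> x a b; rewrite dsum_ractA.
- exact: dsum_ip_linear.
- by move=> x y; rewrite dsum_ip_star.
- exact: dsum_ip_ract.
- by move=> b x y; rewrite lact_adjoint.
- exact: dsum_ip_full.
- exact: dsum_ip_squares.
exact: dsum_local_unit.
Qed.

End Bimodule.

Lemma finrank_ract (T : finrank A L) x a : T (dsum_ract x a) = dsum_ract (T x) a.
Proof.
move: (finrank_fun T) (finrank_in T).
apply: lspan_ind => [|c u v [y [z ->]] vP].
  by apply: eq_dsum => i; rewrite /= amul0l.
rewrite [LHS](_ : _ = c *: Theta y z (dsum_ract x a) + v (dsum_ract x a)) //.
by rewrite Theta_ractl vP -dsum_ractZl -dsum_ractDl.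
Qed.

(** Membership is known only for the underlying operator, among all maps; the induction therefore
    builds an element [U] of the algebra with the same operator. *)
Lemma rank_one_full (T : finrank_alg hA L) :
  T \in lspan [set c | exists x y, c = rank_one hA x y].
Proof.
suff [U UT US] : exists2 U : finrank_alg hA L, finrank_fun U = finrank_fun T &
    U \in lspan [set c | exists x y, c = rank_one hA x y].
  by rewrite -(val_inj UT : U = T).
move: (finrank_fun T) (finrank_in T).
apply: lspan_ind => [|c u v [x [y ->]] [U <- US]].
  by exists 0; rewrite ?rpred0.
exists (c *: rank_one hA x y + U) => //.
by rewrite rpredD ?rpredZ //; apply: lspan_gen; exists x, y.
Qed.

Lemma finrank_Morita_equivalent :
  inhabited L -> formally_Morita_equivalent A (finrank_alg hA L).
Proof.
apply: (@dsum_Morita_equivalent _ (fun T : finrank_alg hA L => finrank_fun T)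
  (rank_one hA (L := L))) => //.
- by move=> T; apply/finrank_linear/finrank_in.
- exact: finrank_ract.
- exact: finrank_starP.
- move=> y c u v; apply: eq_finrank => z.
  by rewrite [LHS](dsum_ractDl _ _ _) dsum_ractZl.
- by move=> x y; rewrite astar_rank_one.
- by move=> T x y; apply: eq_finrank => z; rewrite /= finrank_ract.
- move=> a x y; apply: eq_finrank => z /=.
  (* Taking adjoints twice gives [dsum_ip (dsum_ract y (astar a)) z = a ** dsum_ip y z]. *)
  by rewrite /Theta dsum_ractA -[in RHS]dsum_ip_star dsum_ip_ract astarM astarK
    dsum_ip_star.
exact: rank_one_full.
Qed.

End FreeModuleEquivalence.

(** * Matrix algebras acting on columns *)

Section MatrixEquivalence.
Variables (R : realDomainType) (A : starAlgType R).
Hypothesis hA : has_approximate_identity A.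
Variable n : nat.
Local Notation D := (dsum 'I_n A).
Local Notation M := (mx_alg A n).

Lemma finsupp_ord (f : 'I_n -> A) : f \in @Defs.finsupp (cext R) 'I_n A.
Proof. exact/asboolP/finite_finset. Qed.

Definition col_dsum (f : 'I_n -> A) : D := Dsum (finsupp_ord f).

Lemma dsum_ip_ord (x y : D) : dsum_ip x y = \sum_i astar (x i) ** y i.
Proof.
rewrite /dsum_ip (fsbigE (enum 'I_n)) ?enum_uniq // => [|i _].
  by rewrite big_enum_cond; apply: eq_bigl => i; rewrite in_setT.
by rewrite mem_enum.
Qed.

Definition mx_lact (m : M) (x : D) : D := col_dsum (fun i => \sum_k m i k ** x k).

Definition mx_ip (x y : D) : M := \matrix_(i, j) (x i ** astar (y j)).

Lemma mx_alg_sumE I (s : seq I) (P : pred I) (F : I -> M) i j :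
  (\sum_(k <- s | P k) F k) i j = \sum_(k <- s | P k) F k i j.
Proof.
by apply: (big_morph (fun m : M => m i j)) => [m p|]; rewrite mxE.
Qed.

(** Split [m] into matrices with a single entry [m i j]; each is the inner product of [m i j] placed
    at [i] and a unit for [m i j] placed at [j]. *)
Lemma mx_ip_full (m : M) : m \in lspan [set c | exists x y, c = mx_ip x y].
Proof.
have -> : m = \sum_i \sum_j (\matrix_(k, l)
    (if (k == i) && (l == j) then m i j else 0) : M).
  apply/matrixP => k l; rewrite mx_alg_sumE (bigD1 k) //= [X in _ + X]big1 => [|i ik].
    rewrite addr0 mx_alg_sumE (bigD1 l) //= big1 => [|j jl].
      by rewrite mxE !eqxx addr0.
    by rewrite mxE eqxx eq_sym (negPf jl).
  by rewrite mx_alg_sumE big1 // => j _; rewrite mxE eq_sym (negPf ik).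
apply: rpred_sum => i _; apply: rpred_sum => j _.
have [E [Es EP]] := approximate_unit hA [:: m i j].
apply: lspan_gen; exists (dsum_single i (m i j)), (dsum_single j E).
apply/matrixP => k l; rewrite !mxE /=; case: eqP => _ /=; last by rewrite amul0l.
case: eqP => _; last by rewrite astar0 amul0r.
by rewrite Es (EP _ (mem_head _ _)).2.
Qed.

Lemma mx_Morita_equivalent : (0 < n)%N -> formally_Morita_equivalent A M.
Proof.
move=> n0; apply: (@dsum_Morita_equivalent _ _ hA _ _ mx_lact mx_ip).
- move=> m c x y; apply: eq_dsum => i; rewrite dsumDE dsumZE /= scaler_sumr.
  rewrite -big_split; apply: eq_bigr => k _.
  by rewrite amulDr amulZr.
- move=> c m p; apply: funext => x; apply: eq_dsum => i.
  rewrite [RHS](_ : _ = c *: mx_lact m x i + mx_lact p x i) //=.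
  rewrite scaler_sumr -big_split; apply: eq_bigr => k _.
  by rewrite !mxE amulDl amulZl.
- move=> m p x; apply: eq_dsum => i /=.
  under eq_bigr do rewrite mxE amul_suml.
  under [RHS]eq_bigr do rewrite amul_sumr.
  rewrite exchange_big; apply: eq_bigr => k _; apply: eq_bigr => l _.
  by rewrite amulA.
- move=> m x a; apply: eq_dsum => i /=; rewrite amul_suml.
  by apply: eq_bigr => k _; rewrite amulA.
- move=> m x y; rewrite !dsum_ip_ord /=.
  under eq_bigr do rewrite astar_sum amul_suml.
  under [RHS]eq_bigr do rewrite amul_sumr.
  rewrite exchange_big; apply: eq_bigr => k _; apply: eq_bigr => l _.
  by rewrite mxE astarM astarK amulA.
- move=> y c u v; apply/matrixP => i j.
  by rewrite !mxE dsumDE dsumZE amulDl amulZl.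
- by move=> x y; apply/matrixP => i j; rewrite !mxE astarM astarK.
- move=> m x y; apply/matrixP => i j; rewrite !mxE amul_suml.
  by apply: eq_bigr => k _; rewrite !mxE amulA.
- move=> a x y; apply/matrixP => i j.
  by rewrite !mxE /= astarM astarK amulA.
- exact: mx_ip_full.
- move=> x y z; apply: eq_dsum => i; rewrite /= dsum_ip_ord amul_sumr.
  by apply: eq_bigr => k _; rewrite mxE amulA.
exact: inhabits (Ordinal n0).
Qed.

End MatrixEquivalence.

Theorem proposition6p10 (R : realDomainType) (A : starAlgType R)
    (hA : has_approximate_identity A) :
  (forall L : choiceType, inhabited L ->
     formally_Morita_equivalent A (finrank_alg hA L)) /\
  (forall n : nat, (0 < n)%N -> formally_Morita_equivalent A (mx_alg A n)).
Proof.
split=> [L|n]; first exact: finrank_Morita_equivalent.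
exact: mx_Morita_equivalent.
Qed.
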